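(* For every $p\in[P]$, the threshold $$\underline\beta_p=\min\{\beta\in\mathbb R\mid\Psi_p(\beta)\ge\theta\}$$ exists and is finite. Every decision $z\in\mathcal Z$ feasible for the robust model (i.e. satisfying the robust conditional chance constraint) satisfies the strengthened quantile cut $$\beta_p(z)\ge\underline\beta_p.$$ If the safety system contains only safety constraint $p$, this inequality is also sufficient for the robust chance constraint and therefore gives its exact scalar threshold. Moreover, $$\underline\beta_p>-q_p.$$ Consequently, after adding $\beta_p(z)\ge\underline\beta_p$ to the mixed-integer program (MIP) of the context, every coefficient $M_{ip}$ in the constraints $\delta_i\le m_{ip}(z)+M_{ip}\mathfrak z_i$ can be replaced, without changing the feasible region of (MIP), by $$\widetilde M_{ip}=\min\{M_{ip},[-c_{ip}-\underline\beta_p]_+\}.$$ These coefficients are componentwise no larger than the probability-quantile coefficients $M^{\rm Q}_{ip}=\min\{M_{ip},[q_p-c_{ip}]_+\}$.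
   Context: $[N]=\{1,\dots,N\}$, $[a]_+=\max\{a,0\}$, $\mathbf 1$ all-ones. Two distinct symbols: $\varepsilon\in(0,1]$ (lower bound on the conditioning probability) and $\epsilon\in(0,1)$ (risk limit). $\mathcal X$ is the context space with metric $d_{\mathcal X}$; the outcome space is $\mathcal Y=\mathbb R^{\dim(y)}$ with $d_{\mathcal Y}$ induced by a norm $\|\cdot\|_{\mathcal Y}$ with dual norm $\|\cdot\|_{\mathcal Y,*}$. Samples $(\hat x_i,\hat y_i)$, $i\in[N]$, $\widehat{\mathbb P}_N=\frac1N\sum_i\delta_{(\hat x_i,\hat y_i)}$. $W$ is the type-1 Wasserstein distance with ground metric $d_{\mathcal X}+d_{\mathcal Y}$. $\mathcal N=\mathcal N_\gamma(x_0)\subseteq\mathcal X$ contains $x_0$ and lies within $d_{\mathcal X}$-distance $\gamma\ge0$ of $x_0$ ($\mathcal N_0(x_0)=\{x_0\}$). With $\theta>0$, $\mathcal P_{\theta,\varepsilon}(\mathcal N)=\{\mathbb P:W(\mathbb P,\widehat{\mathbb P}_N)\le\theta,\ \mathbb P_X(\mathcal N)\ge\varepsilon\}$. Safety sets: $\mathcal S(z)=\{y:y^\top b_p+d_p-z^\top a_p>0\ \forall p\in[P]\}$ with $b_p\ne0$; $\mathcal S^c(z)=\mathcal Y\setminus\mathcal S(z)$. The robust conditional chance constraint is $\sup_{\mathbb P\in\mathcal P_{\theta,\varepsilon}(\mathcal N)}\mathbb P[Y\notin\mathcal S(z)\mid X\in\mathcal N]\le\epsilon$. $\mathcal Z$ is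 a nonempty bounded mixed-integer polyhedron and $c$ is linear. Standing assumptions: $\mathcal X,\mathcal Y$ Polish with Borel $\sigma$-fields, transport allowed on all of $\mathcal X\times\mathcal Y$; $\mathcal N$ Borel with finite distances from each $\hat x_i$ to $\mathcal N$ and $\mathcal N^c$; for each $z\in\mathcal Z$, $\mathcal S^c(z)$ is a nonempty Borel set at finite distance from each $\hat y_i$; and $\theta>\theta_{\min}:=\inf\{W(\mathbb P,\widehat{\mathbb P}_N):\mathbb P_X(\mathcal N)\ge\varepsilon\}$. Constants: $\kappa_i^{\rm in}=\inf_{x\in\mathcal N}d_{\mathcal X}(\hat x_i,x)$, $\kappa_i^{\rm out}=\inf_{x\in\mathcal N^c}d_{\mathcal X}(\hat x_i,x)$, $\bar\kappa_i=\kappa_i^{\rm in}-\kappa_i^{\rm out}$, $K_0=\frac1N\sum_i\kappa_i^{\rm out}$. Margins: $c_{ip}=\hat y_i^\top b_p/\|b_p\|_{\mathcal Y,*}$, $\beta_p(z)=(d_p-z^\top a_p)/\|b_p\|_{\mathcal Y,*}$, $m_{ip}(z)=c_{ip}+\beta_p(z)$. Finite constants: $M_{ip}\ge\max_{z\in\mathcal Z}[-m_{ip}(z)]_+$, $\overline\Delta_i\ge\max_{z\in\mathcal Z}[\min_pm_{ip}(z)]_+$. (MIP): minimize $c(z)$ over $(z,\delta,\mathfrak z,t,\lambda,s,v)$ subject to $K_0+\epsilon\varepsilon t-\varepsilon\lambda-\frac1N\sum_iv_i\ge\theta$; and for all $i\in[N]$: $v_i+\lambda\ge s_i$, $\delta_i+\bar\kappa_i\ge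 t-s_i$, $0\le\delta_i\le\overline\Delta_i(1-\mathfrak z_i)$, $\delta_i\le m_{ip}(z)+M_{ip}\mathfrak z_i$ for all $p\in[P]$, $s_i\ge-\bar\kappa_i$, $v_i\ge0$; $\lambda\le\epsilon t$, $t\ge0$, $\lambda\in\mathbb R$, $s\in\mathbb R^N$, $z\in\mathcal Z$, $\mathfrak z\in\{0,1\}^N$. Transportation cost to the risk boundary: with $\mathcal C_{\varepsilon,\epsilon}=\{(w,r):0\le r\le w\le\frac1N\mathbf 1,\ \mathbf 1^\top w\ge\varepsilon,\ \mathbf 1^\top r=\epsilon\mathbf 1^\top w\}$, let $\vartheta(d)=\min_{(w,r)\in\mathcal C_{\varepsilon,\epsilon}}\{K_0+\bar\kappa^\top w+d^\top r\}$ for $d\in\mathbb R^N_+$. For $\beta\in\mathbb R$, $d_i^p(\beta)=[c_{ip}+\beta]_+$ and $\Psi_p(\beta)=\vartheta(d^p(\beta))$. Probability quantile: $\mathcal W_\theta=\{w\in\mathbb R^N:0\le w_i\le\frac1N,\ \mathbf 1^\top w\ge\varepsilon,\ K_0+\bar\kappa^\top w\le\theta\}$; $\rho_\theta(A)=\max_{w\in\mathcal W_\theta}\{\sum_{i\in A}w_i-\epsilon\mathbf 1^\top w\}$ for $A\subseteq[N]$; $q_p=\min\{q\in\{c_{ip}:i\in[N]\}:\rho_\theta(\{i:c_{ip}\le q\})>0\}$. *)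

(* Defs.v *)
From HB Require Import structures.
From mathcomp Require Import all_boot all_order all_algebra.
From mathcomp Require Import all_classical all_reals all_analysis.

Set Implicit Arguments.
Unset Strict Implicit.
Unset Printing Implicit Defensive.

Import Order.TTheory GRing.Theory Num.Theory.
Import numFieldNormedType.Exports.

Local Open Scope classical_set_scope.
Local Open Scope ring_scope.

(* Points are required by [measurableType], hence by the Borel sigma-field. *)
#[short(type="pmetricType")]
HB.structure Definition PMetric (K : numDomainType) :=
  { M of Metric K M & Pointed M }.

Notation borel T := (g_sigma_algebraType (@open T)).

(* Completeness is asked of some compatible metric, not of the given one. *)
Definition polish (R : realType) (X : topologicalType) : Prop :=
  (exists S : set X, countable S /\ dense S) /\
  exists (M : pmetricType R) (f : X -> M) (g : M -> X),
    [/\ cancel f g, cancel g f, continuous f, continuous g &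
        forall F : set_system M, ProperFilter F -> cauchy F -> cvg F].

Definition is_min (R : realType) (S : set R) (m : R) : Prop :=
  S m /\ lbound S m.

Definition pospart (R : realType) (a : R) : R := Num.max a 0.

Definition dot (R : realType) (k : nat) (u v : 'cV[R]_k) : R :=
  (u^T *m v) ord0 ord0.

Definition is_norm (R : realType) (k : nat) (nrm : 'cV[R]_k -> R) : Prop :=
  [/\ forall u v, nrm (u + v) <= nrm u + nrm v,
      forall a u, nrm (a *: u) = `|a| * nrm u &
      forall u, nrm u = 0 -> u = 0].

Definition dual_norm (R : realType) (k : nat) (nrm : 'cV[R]_k -> R)
    (b : 'cV[R]_k) : R :=
  sup [set dot y b | y in [set y | nrm y <= 1]].

Definition mixed_integer_polyhedron (R : realType) (k : nat)
    (Z : set 'cV[R]_k) : Prop :=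
  exists (q : nat) (A : 'M[R]_(q, k)) (g : 'cV[R]_q) (J : {set 'I_k}),
    Z = [set z | (forall i, (A *m z) i ord0 <= g i ord0) /\
                 (forall j, j \in J -> z j ord0 \is a Num.int)].

(* Integrals and infima are extended-real: the value is +oo when no coupling
   has finite cost. *)
Definition wasserstein1 (R : realType) (d : measure_display)
    (T : measurableType d) (dist : T -> T -> R) (mu nu : set T -> \bar R) :
    \bar R :=
  ereal_inf
    [set (\int[pi]_u (dist u.1 u.2)%:E)%E |
      pi in [set pi : probability (T * T)%type R |
        (forall A, measurable A -> pi (A `*` setT) = mu A) /\
        (forall A, measurable A -> pi (setT `*` A) = nu A)]].

(* [nbd] is the conditioning event in the context space, [eps] the lower bound
   on its probability, [risk] the risk limit and [theta] the transport radius;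
   safety constraint p reads y^T coefy_p + offset_p - z^T coefz_p > 0. *)
Record model (R : realType) (X : pmetricType R) (N P m n : nat) := Model {
  xhat : 'I_N -> X;
  yhat : 'I_N -> 'cV[R]_m;
  normY : 'cV[R]_m -> R;
  nbd : set X;
  theta : R;
  eps : R;
  risk : R;
  coefz : 'I_P -> 'cV[R]_n;
  coefy : 'I_P -> 'cV[R]_m;
  offset : 'I_P -> R;
  Zset : set 'cV[R]_n
}.

Record mip_point (R : realType) (N n : nat) := MipPoint {
  mp_z : 'cV[R]_n;
  mp_delta : 'I_N -> R;
  mp_bin : 'I_N -> bool;
  mp_t : R;
  mp_lambda : R;
  mp_s : 'I_N -> R;
  mp_v : 'I_N -> R
}.

Section Model.
Context (R : realType) (X : pmetricType R) (N P m n : nat).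
Variable D : model X N P m n.

Notation Y := 'cV[R]_m.
Notation XY := (borel X * borel Y)%type.

(* The sigma-field on XY is the product one; it is the Borel sigma-field of the
   product space when X is Polish, both factors being second countable. *)
Definition dist_XY (u v : XY) : R :=
  mdist (u.1 : X) v.1 + normY D ((u.2 : Y) - v.2).

Definition empirical (A : set XY) : \bar R :=
  ((N%:R^-1 : R)%:E * \sum_(i < N) \d_((xhat D i, yhat D i) : XY) A)%E.

Definition Wdist (Q : probability XY R) : \bar R :=
  wasserstein1 dist_XY Q empirical.

Definition proba_nbd (Q : probability XY R) : \bar R := Q (nbd D `*` setT).

Definition ambiguity : set (probability XY R) :=
  [set Q | (Wdist Q <= (theta D)%:E)%E /\ ((eps D)%:E <= proba_nbd Q)%E].

Definition theta_min : \bar R :=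
  ereal_inf [set Wdist Q | Q in [set Q | ((eps D)%:E <= proba_nbd Q)%E]].

Definition safe (z : 'cV[R]_n) : set Y :=
  [set y | forall p : 'I_P,
     0 < dot y (coefy D p) + offset D p - dot z (coefz D p)].

Definition unsafe (z : 'cV[R]_n) : set Y := ~` safe z.

Definition cond_violation (z : 'cV[R]_n) (Q : probability XY R) : R :=
  fine (Q (nbd D `*` unsafe z)) / fine (proba_nbd Q).

Definition robust_cc (z : 'cV[R]_n) : Prop :=
  (ereal_sup [set (cond_violation z Q)%:E | Q in ambiguity]
     <= (risk D)%:E)%E.

(* Real infima: genuine distances as long as nbd and its complement are
   nonempty. *)
Definition kappa_in (i : 'I_N) : R :=
  inf [set mdist (xhat D i) x | x in nbd D].

Definition kappa_out (i : 'I_N) : R :=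
  inf [set mdist (xhat D i) x | x in ~` nbd D].

Definition kappa_bar (i : 'I_N) : R := kappa_in i - kappa_out i.

Definition K0 : R := N%:R^-1 * \sum_(i < N) kappa_out i.

Definition yproj (i : 'I_N) (p : 'I_P) : R :=
  dot (yhat D i) (coefy D p) / dual_norm (normY D) (coefy D p).

Definition betaz (p : 'I_P) (z : 'cV[R]_n) : R :=
  (offset D p - dot z (coefz D p)) / dual_norm (normY D) (coefy D p).

Definition margin (i : 'I_N) (p : 'I_P) (z : 'cV[R]_n) : R :=
  yproj i p + betaz p z.

(* Infimum over a finite family: the minimum as soon as 0 < P. *)
Definition min_margin (i : 'I_N) (z : 'cV[R]_n) : R :=
  inf [set margin i p z | p in [set: 'I_P]].

(* The first component is the mass w_i moved into (or kept in) nbd, the second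
   the part r_i of it that is unsafe. *)
Definition boundary_polytope : set (('I_N -> R) * ('I_N -> R)) :=
  [set wr | [/\ forall i, 0 <= wr.2 i <= wr.1 i,
                forall i, wr.1 i <= N%:R^-1,
                eps D <= \sum_(i < N) wr.1 i &
                \sum_(i < N) wr.2 i = risk D * \sum_(i < N) wr.1 i]].

(* For 0 < N and eps <= 1 the polytope is nonempty and compact, so this
   infimum is a minimum. *)
Definition vartheta (dd : 'I_N -> R) : R :=
  inf [set K0 + \sum_(i < N) kappa_bar i * wr.1 i + \sum_(i < N) dd i * wr.2 i
      | wr in boundary_polytope].

Definition Psi (p : 'I_P) (bt : R) : R :=
  vartheta (fun i => pospart (yproj i p + bt)).

Definition quantile_polytope : set ('I_N -> R) :=
  [set w | [/\ forall i, 0 <= w i <= N%:R^-1,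
               eps D <= \sum_(i < N) w i &
               K0 + \sum_(i < N) kappa_bar i * w i <= theta D]].

(* The polytope is compact, and nonempty when theta_min < theta: the supremum
   is then a maximum. *)
Definition rho (A : {set 'I_N}) : R :=
  sup [set \sum_(i in A) w i - risk D * \sum_(i < N) w i
      | w in quantile_polytope].

(* Infimum of a finite set of reals, nonempty when theta_min < theta. *)
Definition quantile (p : 'I_P) : R :=
  inf [set q | (exists i, q = yproj i p) /\
               0 < rho [set i | yproj i p <= q]%SET].

Definition mip_feasible (M : 'I_N -> 'I_P -> R) (Dl : 'I_N -> R) :
    set (mip_point R N n) :=
  [set u |
    [/\ theta D <= K0 + risk D * eps D * mp_t u - eps D * mp_lambda u
                   - N%:R^-1 * \sum_(i < N) mp_v u i,
        forall i : 'I_N,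
          [/\ mp_s u i <= mp_v u i + mp_lambda u,
              mp_t u - mp_s u i <= mp_delta u i + kappa_bar i,
              0 <= mp_delta u i <= Dl i * (1 - (mp_bin u i)%:R),
              forall p : 'I_P, mp_delta u i <=
                margin i p (mp_z u) + M i p * (mp_bin u i)%:R &
              - kappa_bar i <= mp_s u i /\ 0 <= mp_v u i],
        mp_lambda u <= risk D * mp_t u,
        0 <= mp_t u &
        Zset D (mp_z u)]].

Definition quantile_cuts (bl : 'I_P -> R) (Q : {set 'I_P}) :
    set (mip_point R N n) :=
  [set u | forall p, p \in Q -> bl p <= betaz p (mp_z u)].

Definition M_tilde (M : 'I_N -> 'I_P -> R) (bl : 'I_P -> R)
    (i : 'I_N) (p : 'I_P) : R :=
  Num.min (M i p) (pospart (- yproj i p - bl p)).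

Definition M_quantile (M : 'I_N -> 'I_P -> R) (i : 'I_N) (p : 'I_P) : R :=
  Num.min (M i p) (pospart (quantile p - yproj i p)).

Definition M_replaced (M : 'I_N -> 'I_P -> R) (bl : 'I_P -> R)
    (Q : {set 'I_P}) (i : 'I_N) (p : 'I_P) : R :=
  if p \in Q then M_tilde M bl i p else M i p.

End Model.

(* Main.v *)
From HB Require Import structures.
Require Import Defs.
From mathcomp Require Import all_boot all_order all_algebra.
From mathcomp Require Import all_classical all_reals all_analysis.
From mathcomp Require Import measurable_realfun.
From mathcomp Require Import ring lra.

Import Order.TTheory GRing.Theory Num.Theory.
Import numFieldNormedType.Exports.

Local Open Scope classical_set_scope.
Local Open Scope ring_scope.

(** A distribution in the ambiguity set puts mass [w i <= 1/N] of each sample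
    [i] into the conditioning event, and a part [r i <= w i] of it on the unsafe
    side. Moving the context costs [kappa_in i] on the mass [w i] and
    [kappa_out i] on the rest, and moving the outcome costs [r i] times the
    distance from [yhat i] to the unsafe set, so the cheapest plan with given
    weights costs [boundary_cost dd w r], an affine function of [(w, r)].
    [coupling_weights] extracts such weights from an arbitrary transport plan,
    and [attack] turns weights into a finitely supported plan of almost the same
    cost. The chance constraint is thereby reduced to the linear program
    [vartheta].

    For the half-space of one constraint [p] the distance is the positive part
    of the margin [yproj i p + betaz p z], by duality of norms, so the linear
    program takes the value [Psi p (betaz p z)], which depends on [z] through a
    scalar only. As [Psi p] is nondecreasing, continuous and unbounded, its
    superlevel set at [theta] is a closed half-line as soon as it is bounded
    below, and the endpoint is the threshold. A robust decision has
    [theta <= Psi p (betaz p z)]: below the threshold some plan reaches the risk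
    boundary strictly within the budget, and since the risk limit is less than
    one, slightly more mass can be made unsafe.

    Two statements need a strict inequality where the data give only
    [Psi <= theta]: that the cut is sufficient for a single constraint, and that
    the threshold exceeds [- quantile p]. In both, the plan at hand has strictly
    more unsafe mass than the risk limit. The assumption
    [theta_min < theta] provides weights that are strictly affordable
    ([slater_weights]); mixing in a little of them uses up the excess of unsafe
    mass and makes the cost strictly smaller than [theta]
    ([vartheta_lt_excess]).

    Finally the multipliers of a point feasible for the mixed-integer program
    certify [theta <= Psi p (betaz p z)] by weak duality ([mip_Psi_ge]), so such
    a point satisfies every cut. Under the cut, a margin is at least
    [yproj i p + bl p], hence [- yproj i p - bl p] is large enough to deactivate
    the constraint. *)

(** * Norms of finite-dimensional spaces and distances to half-spaces *)

Section DotProduct.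
Context {R : realType} {m : nat}.
Implicit Types u v b : 'cV[R]_m.

Lemma dotE u v : dot u v = \sum_i u i ord0 * v i ord0.
Proof. by rewrite /dot mxE; apply: eq_bigr => i _; rewrite mxE. Qed.

Lemma dotDl u v b : dot (u + v) b = dot u b + dot v b.
Proof. by rewrite /dot linearD/= mulmxDl mxE. Qed.

Lemma dotZl a u b : dot (a *: u) b = a * dot u b.
Proof. by rewrite /dot linearZ/= -scalemxAl mxE. Qed.

Lemma dotNl u b : dot (- u) b = - dot u b.
Proof. by rewrite -scaleN1r dotZl mulN1r. Qed.

Lemma dot0l b : dot 0 b = 0.
Proof. by rewrite -(scale0r 0) dotZl mul0r. Qed.

Lemma dot_self_gt0 b : b <> 0 -> 0 < dot b b.
Proof.
move=> b0; have nn i : true -> 0 <= b i ord0 * b i ord0.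
  by rewrite -expr2 sqr_ge0.
rewrite dotE lt_neqAle sumr_ge0 // andbT eq_sym.
apply: contra_notN b0; rewrite psumr_eq0 // => /allP h.
apply/matrixP => i j; rewrite ord1 mxE.
by have := h i (mem_index_enum i); rewrite /= mulf_eq0 orbb => /eqP.
Qed.

End DotProduct.

Section Norm.
Context {R : realType} {m : nat} {nrm : 'cV[R]_m -> R} (hn : is_norm nrm).
Implicit Types u v b : 'cV[R]_m.

Lemma is_norm0 : nrm 0 = 0.
Proof. by case: hn => _ hZ _; rewrite -(scale0r 0) hZ normr0 mul0r. Qed.

Lemma is_normN u : nrm (- u) = nrm u.
Proof. by case: hn => _ hZ _; rewrite -scaleN1r hZ normrN1 mul1r. Qed.

Lemma is_norm_ge0 u : 0 <= nrm u.
Proof.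
case: hn => hD _ _; have := hD u (- u).
by rewrite subrr is_norm0 is_normN -mulr2n pmulrn_lge0.
Qed.

Lemma is_norm_gt0 u : u <> 0 -> 0 < nrm u.
Proof.
case: hn => _ _ h0 u0; rewrite lt_neqAle is_norm_ge0 andbT eq_sym.
by apply: contra_notN u0 => /eqP/h0.
Qed.

Lemma is_norm_le_sup :
  exists C, 0 <= C /\ forall v : 'rV[R]_m, nrm v^T <= C * `|v|.
Proof.
case: hn => hD hZ _.
exists (\sum_(i < m) nrm (delta_mx i ord0)).
split; first by apply: sumr_ge0 => i _; apply: is_norm_ge0.
move=> v; rewrite (matrix_sum_delta v^T).
have -> : \sum_i \sum_j v^T i j *: delta_mx i j
        = \sum_(i < m) v ord0 i *: delta_mx i (ord0 : 'I_1).
  by apply: eq_bigr => i _; rewrite big_ord1 mxE.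
apply: (@le_trans _ _ (\sum_(i < m) nrm (v ord0 i *: delta_mx i ord0))).
  elim/big_ind2 : _ => [|x1 x2 y1 y2 h1 h2|//]; first by rewrite is_norm0.
  by rewrite (le_trans (hD _ _)) // lerD.
rewrite mulr_suml; apply: ler_sum => i _; rewrite hZ mulrC.
apply: ler_wpM2l; first exact: is_norm_ge0.
rewrite [leRHS]/Num.norm /= mx_normrE; apply/bigmax_geP; right => /=.
by exists (ord0, i).
Qed.

Lemma is_norm_continuous : continuous (fun v : 'rV[R]_m => nrm v^T).
Proof.
case: hn => hD hZ _; have [C [C0 hC]] := is_norm_le_sup.
have tri a b : nrm a - nrm b <= nrm (a - b).
  by rewrite lerBlDr (le_trans _ (hD _ _)) // subrK.
move=> v; apply/(@cvgrPdist_lt _ _ _ _ (nbhs_filter v)) => e e0.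
apply/(@nbhs_normP R 'rV[R]_m v).
exists (e / (C + 1)); first by rewrite /= divr_gt0 // ltr_wpDl.
move=> w /= hw.
have h : nrm (v - w)^T < e.
  rewrite (le_lt_trans (hC _)) //.
  apply: (@le_lt_trans _ _ ((C + 1) * `|v - w|)).
    by rewrite ler_wpM2r // lerDl.
  by rewrite mulrC -ltr_pdivlMr ?ltr_wpDl.
apply: le_lt_trans h; rewrite ler_norml linearB/= tri andbT.
by rewrite lerNl opprB (le_trans (tri _ _)) // -opprB is_normN.
Qed.

(** All norms of a finite-dimensional space are equivalent: on the unit sphere
    of the sup norm, which is compact, the norm has a positive minimum. *)
Lemma is_norm_ge_sup :
  exists c, 0 < c /\ forall v : 'rV[R]_m, c * `|v| <= nrm v^T.
Proof.
pose S := [set v : 'rV[R]_m | `|v| = 1].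
have toS (v : 'rV[R]_m) : v != 0 -> S (`|v|^-1 *: v).
  by move=> v0; rewrite /S/= normrZ normfV normr_id mulVf // normr_eq0.
have [S0|S0] := pselect (S !=set0); last first.
  exists 1; split=> // v; have [->|/toS vS] := eqVneq v 0.
    by rewrite normr0 mulr0; apply: is_norm_ge0.
  by case: S0; exists (`|v|^-1 *: v).
have cS : compact S.
  apply: bounded_closed_compact.
    exists 1; split; first exact: num_real.
    by move=> x x1 v; rewrite /S/= => ->; apply: ltW.
  have -> : S = (fun v : 'rV[R]_m => `|v|) @^-1` [set 1] by [].
  apply: preimage_closed; last exact: closed_eq.
  by move=> x _; exact: (@norm_continuous R 'rV[R]_m).
have [c cS' hc] := @EVT_min_rV R m (fun v : 'rV[R]_m => nrm v^T) S S0 cS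
  (continuous_subspaceT is_norm_continuous).
have c0 : 0 < nrm c^T.
  apply: is_norm_gt0 => /(congr1 trmx); rewrite trmxK trmx0 => cz.
  move: cS'; rewrite inE /S/= cz normr0 => /eqP.
  by rewrite eq_sym oner_eq0.
exists (nrm c^T); split => // v; have [->|v0] := eqVneq v 0.
  by rewrite normr0 mulr0; apply: is_norm_ge0.
have := hc _ (mem_set (toS _ v0)); case: hn => _ hZ _.
rewrite linearZ/= hZ normfV normr_id.
by rewrite ler_pdivlMl ?normr_gt0 // mulrC.
Qed.

Lemma dot_bounded b : exists C, 0 <= C /\ forall u, `|dot u b| <= C * nrm u.
Proof.
have [c [c0 hc]] := is_norm_ge_sup.
exists ((\sum_i `|b i ord0|) / c); split.
  by rewrite divr_ge0 ?(ltW c0) // sumr_ge0.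
move=> u; rewrite dotE (le_trans (ler_norm_sum _ _ _)) // -mulrA mulr_suml.
apply: ler_sum => i _; rewrite normrM mulrC ler_wpM2l //.
rewrite ler_pdivlMl //; apply: (le_trans _ (_ : c * `|u^T| <= _)); last first.
  by have := hc u^T; rewrite trmxK.
rewrite ler_wpM2l ?(ltW c0) //.
rewrite [leRHS]/Num.norm /= mx_normrE; apply/bigmax_geP; right => /=.
by exists (ord0, i); rewrite // mxE.
Qed.

Let dual_set b := [set dot y b | y in [set y | nrm y <= 1]].

Lemma dual_set_has_sup b : has_sup (dual_set b).
Proof.
split; first by exists (dot 0 b), 0; rewrite //= is_norm0.
have [C [C0 hC]] := dot_bounded b; exists C => _ [y /= y1 <-].
rewrite (le_trans (ler_norm _)) // (le_trans (hC y)) //.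
by rewrite -[leRHS]mulr1 ler_wpM2l.
Qed.

Lemma dot_le_dual b u : dot u b <= dual_norm nrm b * nrm u.
Proof.
have [->|/eqP u0] := eqVneq u 0; first by rewrite dot0l is_norm0 mulr0.
have nu := is_norm_gt0 u u0.
have : dot ((nrm u)^-1 *: u) b <= dual_norm nrm b.
  apply: sup_upper_bound; first exact: dual_set_has_sup.
  exists ((nrm u)^-1 *: u) => //=; case: hn => _ hZ _.
  by rewrite hZ ger0_norm ?invr_ge0 ?(ltW nu) // mulVf // gt_eqF.
by rewrite dotZl ler_pdivrMl // mulrC.
Qed.

Lemma dual_norm_gt0 b : b <> 0 -> 0 < dual_norm nrm b.
Proof.
move=> b0; have := dot_le_dual b b.
move/(lt_le_trans (dot_self_gt0 b b0)).
by rewrite pmulr_lgt0 // is_norm_gt0.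
Qed.

(** The two lemmas below compute the distance from [y] to the half-space
    [dot _ b + a <= 0]. The decrease of [dot _ b] that is required is at most the
    dual norm times the length of the displacement. *)
Lemma halfspace_dist_ge b a y y' : b <> 0 -> dot y' b + a <= 0 ->
  pospart ((dot y b + a) / dual_norm nrm b) <= nrm (y' - y).
Proof.
move=> b0 hy'; rewrite /pospart ge_max is_norm_ge0 andbT.
rewrite ler_pdivrMr ?dual_norm_gt0 //.
have := dot_le_dual b (y - y'); rewrite dotDl dotNl.
rewrite -(is_normN (y - y')) opprB; lra.
Qed.

(** The dual norm is a supremum: the bound is approached by moving along a
    direction of the unit ball on which [dot _ b] almost attains it. *)
Lemma halfspace_dist_approx b a y e : b <> 0 -> 0 < e ->
  exists y', dot y' b + a <= 0 /\
    nrm (y' - y) <= pospart ((dot y b + a) / dual_norm nrm b) + e.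
Proof.
move=> b0 e0; have B0 := dual_norm_gt0 b b0.
set B := dual_norm nrm b in B0 *; set s := dot y b + a.
have [s0|s0] := leP s 0.
  exists y; split => //; rewrite subrr is_norm0 addr_ge0 ?(ltW e0) //.
  by rewrite /pospart le_max lexx orbT.
(* A direction [u] with [dot u b] above [B s / (s + B e)] makes the
   displacement [s / dot u b] at most [s / B + e]. *)
have h : B * (s / (s + B * e)) < B.
  rewrite -[ltRHS]mulr1 ltr_pM2l // ltr_pdivrMr ?mul1r ?ltrDl ?mulr_gt0 //.
  by rewrite addr_gt0 ?mulr_gt0.
have gap : 0 < B - B * (s / (s + B * e)) by rewrite subr_gt0.
have [_ [u /= u1 <-]] := sup_adherent gap (dual_set_has_sup b).
rewrite (_ : sup _ = B) // opprB addrCA subrr addr0 => hu.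
have c0 : 0 < B * (s / (s + B * e)).
  by rewrite mulr_gt0 // divr_gt0 // addr_gt0 // mulr_gt0.
have ub : 0 < dot u b by apply: lt_trans hu.
exists (y - (s / dot u b) *: u); split.
  by rewrite dotDl dotNl dotZl divfK ?gt_eqF // /s; lra.
rewrite addrC addKr is_normN; case: hn => _ hZ _; rewrite hZ.
rewrite ger0_norm; last by rewrite divr_ge0 // ltW.
apply: (@le_trans _ _ (s / dot u b)).
  by rewrite -[leRHS]mulr1 ler_wpM2l // divr_ge0 // ltW.
rewrite -lerBlDr le_max; apply/orP; left.
rewrite lerBlDr ler_pdivrMr //.
have sBe : 0 < s + B * e by rewrite addr_gt0 // mulr_gt0.
apply: (@le_trans _ _ ((s / B + e) * (B * (s / (s + B * e))))); last first.
  by rewrite ler_pM2l ?(ltW hu) // addr_gt0 // divr_gt0.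
suff -> : (s / B + e) * (B * (s / (s + B * e))) = s by [].
by field; rewrite gt_eqF // gt_eqF.
Qed.

End Norm.

(** * Integrals of arbitrary nonnegative functions and finite mixtures *)

Section IntegralBounds.
Context {d : measure_display} {T : measurableType d} {R : realType}.
Local Open Scope ereal_scope.

(** The integral of a nonnegative function is the supremum of the integrals of
    the simple functions below it, hence monotone on arbitrary integrands, such
    as a metric on a product of Borel sigma-fields. *)
Lemma le_integral_nonneg (mu : {measure set T -> \bar R}) (f g : T -> \bar R) :
  (forall x, 0 <= f x) -> (forall x, f x <= g x) ->
  \int[mu]_x f x <= \int[mu]_x g x.
Proof.
move=> f0 fg; have g0 x : 0 <= g x := le_trans (f0 x) (fg x).
rewrite !ge0_integralTE //; apply: ge_ereal_sup => _ [h hf <-].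
by apply: ereal_sup_ubound; exists h => // x; apply: le_trans (fg x).
Qed.

End IntegralBounds.

Section FiniteMixture.
Context {d : measure_display} {T : measurableType d} {R : realType}.
Context {K : finType} (c : K -> {nonneg R}) (a : K -> T).
Local Open Scope ereal_scope.
Import HBNNSimple.

(* Finite sums of measures are indexed by natural numbers, so [K] is
   enumerated. *)
Let summand (k : nat) : {measure set T -> \bar R} :=
  match insub k : option 'I_#|K| with
  | Some i => mscale (c (enum_val i)) (dirac (a (enum_val i)))
  | None => mzero
  end.

Let summandE A : msum summand #|K| A = \sum_(k : K) (c k)%:num%:E * \d_(a k) A.
Proof.
rewrite /msum (reindex (@enum_val K K)) /=; last first.
  by apply: onW_bij; apply: enum_val_bij.
rewrite (eq_bigl xpredT); last by [].
apply: eq_bigr => i _; rewrite /summand.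
case: insubP => [j _ /val_inj ->|]; last by rewrite ltn_ord.
by [].
Qed.

Let integral_summand (h : {nnsfun T >-> R}) :
  \int[msum summand #|K|]_x (h x)%:E = (\sum_(k : K) (c k)%:num * h (a k))%R%:E.
Proof.
have mh : measurable_fun setT (fun x => (h x)%:E) by exact/measurable_EFinP.
rewrite ge0_integral_measure_sum //; last by move=> x _; rewrite lee_fin.
rewrite (reindex (@enum_val K K)) /=; last first.
  by apply: onW_bij; apply: enum_val_bij.
rewrite [in RHS](eq_bigl xpredT) // -sumEFin.
apply: eq_bigr => i _; rewrite /summand.
case: insubP => [j _ /val_inj ->|]; last by rewrite ltn_ord.
rewrite ge0_integral_mscale //; last by move=> x _; rewrite lee_fin.
by rewrite integral_dirac // diracT mul1e EFinM.
Qed.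

Let mixture : set T -> \bar R := msum summand #|K|.
HB.instance Definition _ := Measure.copy mixture (msum summand #|K|).

Hypothesis c1 : (\sum_k (c k)%:num = 1)%R.

Let mixtureT : mixture setT = 1.
Proof.
rewrite /mixture summandE (eq_bigr (fun k => (c k)%:num%:E)).
  by rewrite sumEFin c1.
by move=> k _; rewrite diracT mule1.
Qed.

HB.instance Definition _ := Measure_isProbability.Build _ _ _ mixture mixtureT.

Lemma finite_mixture_nonneg : exists Q : probability T R,
  (forall A, Q A = \sum_(k : K) (c k)%:num%:E * \d_(a k) A) /\
  forall f : T -> R, (forall x, 0 <= f x)%R ->
    \int[Q]_x (f x)%:E <= (\sum_(k : K) (c k)%:num * f (a k))%R%:E.
Proof.
exists mixture; split=> [A|f f0]; first exact: summandE.
rewrite ge0_integralTE //; apply: ge_ereal_sup => _ [h /= hf <-].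
rewrite -integralT_nnsfun integral_summand lee_fin; apply: ler_sum => k _.
by rewrite ler_wpM2l // -lee_fin.
Qed.

End FiniteMixture.

(** The integral of an arbitrary [f] against a finite mixture of Dirac masses is
    only bounded above: a simple function below [f] is integrated exactly, and
    its values at the points [a k] are at most those of [f]. *)
Lemma finite_mixture {d} {T : measurableType d} {R : realType} {K : finType}
    (c : K -> R) (a : K -> T) : (forall k, 0 <= c k) -> \sum_k c k = 1 ->
  exists Q : probability T R,
    (forall A, Q A = (\sum_(k : K) c k * \1_A (a k))%:E) /\
    forall f : T -> R, (forall x, 0 <= f x) ->
      (\int[Q]_x (f x)%:E <= (\sum_(k : K) c k * f (a k))%:E)%E.
Proof.
move=> c0 c1.
have [Q [QE Qint]] := finite_mixture_nonneg (fun k => NngNum (c0 k)) a c1.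
exists Q; split=> // A; rewrite QE -sumEFin; apply: eq_bigr => k _.
by rewrite EFinM.
Qed.

(** * Couplings with a finitely supported marginal *)

Section AtomicCoupling.
Context {dT dS : measure_display} {T : measurableType dT} {S : measurableType dS}.
Context {R : realType} {N : nat} (a : 'I_N -> S) (mu : probability (T * S)%type R).
Hypothesis ma : forall i, measurable [set a i].
Hypothesis hmu : forall B, measurable B ->
  mu (setT `*` B) = ((N%:R^-1)%:E * \sum_(i < N) \d_(a i) B)%E.

(** Samples may coincide: the mass of an atom is shared equally between the
    indices of the samples located there. *)
Definition multiplicity (i : 'I_N) : nat := #|[set j | a j == a i]%SET|.

Definition atom_mass (A : set T) (i : 'I_N) : R :=
  fine (mu (A `*` [set a i])) / (multiplicity i)%:R.

Let multiplicity_gt0 i : 0 < (multiplicity i)%:R :> R.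
Proof. by rewrite ltr0n card_gt0; apply/set0Pn; exists i; rewrite inE. Qed.

Let matom A i :
  measurable A -> measurable (A `*` [set a i] : set (T * S)%type).
Proof. by move=> mA; apply: measurableX. Qed.

Let mu_fin A : measurable A -> (mu A \is a fin_num).
Proof.
move=> mA; rewrite ge0_fin_numE // (le_lt_trans (probability_le1 _ mA)) //.
exact: ltry.
Qed.

Lemma atom_mass_ge0 A i : 0 <= atom_mass A i.
Proof. by rewrite divr_ge0 // fine_ge0. Qed.

Lemma atom_mass_mono A B i : measurable A -> measurable B -> A `<=` B ->
  atom_mass A i <= atom_mass B i.
Proof.
move=> mA mB AB; rewrite ler_wpM2r ?invr_ge0 ?(ltW (multiplicity_gt0 i)) //.
apply: fine_le; rewrite ?mu_fin //; try exact: matom.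
apply: le_measure; rewrite ?inE; try exact: matom.
by move=> [u v] [/= /AB].
Qed.

Lemma atom_mass_setC A i : measurable A ->
  atom_mass A i + atom_mass (~` A) i = N%:R^-1.
Proof.
move=> mA; rewrite /atom_mass -mulrDl.
have mAC : measurable (~` A) by exact: measurableC.
rewrite -fineD ?mu_fin //; try exact: matom.
rewrite -measureU; try exact: matom; last first.
  by rewrite -subset0 => -[u v] [[/= ? _] [/= ? _]].
have -> : A `*` [set a i] `|` ~` A `*` [set a i] = setT `*` [set a i].
  apply/seteqP; split => [[u v] [[]|[]]//|[u v] [_ /= vi]].
  by have [Au|Au] := pselect (A u); [left|right].
have muE : mu (setT `*` [set a i]) = (N%:R^-1 * (multiplicity i)%:R)%:E.
  rewrite hmu // EFinM; congr (_ * _)%E.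
  rewrite /multiplicity -sum1_card natr_sum -sumEFin [RHS]big_mkcond /=.
  apply: eq_bigr => j _; rewrite diracE inE.
  have [->|ji] := eqVneq (a j) (a i); first by rewrite mem_set.
  by rewrite memNset //=; apply/eqP.
by apply: (canLR (mulfK _)); rewrite ?gt_eqF //; exact: (congr1 fine muE).
Qed.

(* The density of [c] carried by [A]: at the point [(u, v)] it averages [c]
   over the samples located at [v]. *)
Let layer (A : set T) (c : 'I_N -> R) (x : T * S) : R :=
  \sum_i (c i / (multiplicity i)%:R) * \1_(A `*` [set a i]) x.

Let layer_ge0 A c x : (forall i, 0 <= c i) -> 0 <= layer A c x.
Proof. by move=> c0; apply: sumr_ge0 => i _; rewrite mulr_ge0 // divr_ge0. Qed.

Let measurable_layer A c : measurable A -> measurable_fun setT (layer A c).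
Proof.
move=> mA; apply: measurable_sum => i; apply: measurable_funM => //.
by apply: measurable_indic; apply: matom.
Qed.

Let measurable_atom_term A i (r : R) : measurable A ->
  measurable_fun setT (fun x : T * S => (r * \1_(A `*` [set a i]) x)%:E).
Proof.
move=> mA; apply/measurable_EFinP; apply: measurable_funM => //.
by apply: measurable_indic; apply: matom.
Qed.

Let integral_layer A c : measurable A -> (forall i, 0 <= c i) ->
  (\int[mu]_x (layer A c x)%:E = (\sum_i c i * atom_mass A i)%:E)%E.
Proof.
move=> mA c0; under eq_integral do rewrite /layer -sumEFin.
rewrite ge0_integral_sum //; last 2 first.
- by move=> i; apply: measurable_atom_term.
- by move=> i x _; rewrite lee_fin mulr_ge0 // divr_ge0.
rewrite -sumEFin; apply: eq_bigr => i _.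
under eq_integral do rewrite EFinM.
rewrite ge0_integralZl //; last 2 first.
- by apply/measurable_EFinP; apply: measurable_indic; apply: matom.
- by rewrite lee_fin divr_ge0.
rewrite integral_indic //; last exact: matom.
rewrite setIT /atom_mass -[X in (_ * X)%E = _]fineK ?mu_fin //; last exact: matom.
by rewrite -EFinM; congr EFin; ring.
Qed.

Let sum_share (v : S) : \sum_i (multiplicity i)%:R^-1 * \1_[set a i] v
   = (v \in range a)%:R :> R.
Proof.
have [/set_mem [j _ aj]|vN] := boolP (v \in range a); last first.
  rewrite big1 // => i _; rewrite indicE memNset ?mulr0 //= => vi.
  by move/negP: vN; apply; rewrite inE; exists i.
rewrite (bigID (fun i => a i == a j)) /= [X in _ + X]big1 ?addr0; last first.
  move=> i /eqP ij; rewrite indicE memNset ?mulr0 //= => vi.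
  by apply: ij; rewrite -vi aj.
rewrite (eq_bigr (fun=> (multiplicity j)%:R^-1)); last first.
  move=> i /eqP ij; have -> : \1_[set a i] v = 1 :> R.
    by rewrite indicE mem_set //= -aj ij.
  by rewrite mulr1 /multiplicity ij.
rewrite sumr_const -[LHS]mulr_natl.
have -> : #|[pred i | a i == a j]| = multiplicity j.
  by apply: eq_card => i; rewrite !inE.
by rewrite mulfV // gt_eqF.
Qed.

Let layerE A c u v : layer A c (u, v)
  = \sum_i (multiplicity i)%:R^-1 * \1_[set a i] v * (c i * \1_A u).
Proof.
apply: eq_bigr => i _; rewrite !indicE in_setX /= -mulnb natrM; ring.
Qed.

Lemma sum_atom_mass A : measurable A ->
  \sum_i atom_mass A i = fine (mu (A `*` setT)).
Proof.
move=> mA; have mr : measurable (range a).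
  have -> : range a = \bigcup_(i in [set: 'I_N]) [set a i].
    by rewrite -bigcup_imset1.
  by apply: fin_bigcup_measurable => //; exact: finite_finset.
have -> : mu (A `*` setT) = mu (A `*` range a).
  have -> : A `*` setT = (A `*` range a) `|` (A `*` ~` range a).
    apply/seteqP; split => [[u v] [/= Au _]|[u v] [[]|[]]//].
    by have [rv|rv] := pselect (range a v); [left|right].
  rewrite measureU //; try exact: measurableX (measurableC mr);
    try exact: measurableX.
    rewrite [X in (_ + X)%E](_ : _ = 0%E) ?adde0 //.
    apply/eqP; rewrite eq_le measure_ge0 andbT.
    have <- : mu (setT `*` ~` range a) = 0%E.
      rewrite hmu; last exact: measurableC.
      rewrite big1 ?mule0 // => i _; rewrite diracE memNset //= .
      by apply; exists i.
    apply: le_measure; rewrite ?inE; try exact: measurableX (measurableC mr).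
    by move=> [u v] [].
  by rewrite -subset0 => -[u v] [[/= _ h] [/= _ /(_ h)]].
apply: EFin_inj; rewrite fineK ?mu_fin //; last exact: measurableX.
have mAr : measurable (A `*` range a : set (T * S)%type) by exact: measurableX.
have muE := integral_indic mu measurableT mAr; rewrite setIT in muE.
refine (etrans _ muE); rewrite {muE}.
have -> : (\sum_i atom_mass A i) = \sum_i (1 * atom_mass A i).
  by apply: eq_bigr => i _; rewrite mul1r.
rewrite -(integral_layer A (fun=> 1)) //; apply: eq_integral => -[u v] _.
rewrite layerE; under eq_bigr do rewrite mul1r.
rewrite -mulr_suml sum_share !indicE in_setX /= andbC -mulnb natrM.
by [].
Qed.

(** The second coordinate lies almost surely on an atom, so that a lower bound of
    the cost at the atoms only, piecewise constant in the first coordinate,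
    integrates to a bound by the masses of the pieces. *)
Lemma coupling_cost_ge (f : T * S -> R) (A B : set T) (c1 c2 c3 : 'I_N -> R) :
  measurable A -> measurable B -> (forall x, 0 <= f x) ->
  (forall i, [/\ 0 <= c1 i, 0 <= c2 i & 0 <= c3 i]) ->
  (forall u i, c1 i * \1_A u + c2 i * \1_(~` A) u + c3 i * \1_B u
               <= f (u, a i)) ->
  ((\sum_i c1 i * atom_mass A i + \sum_i c2 i * atom_mass (~` A) i
    + \sum_i c3 i * atom_mass B i)%:E <= \int[mu]_x (f x)%:E)%E.
Proof.
move=> mA mB f0 c0 hf.
have c10 i : 0 <= c1 i by case: (c0 i).
have c20 i : 0 <= c2 i by case: (c0 i).
have c30 i : 0 <= c3 i by case: (c0 i).
have mAC : measurable (~` A) by exact: measurableC.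
rewrite 2!EFinD -!integral_layer // -!ge0_integralD //;
  try (by move=> x _; rewrite -?EFinD lee_fin ?addr_ge0 ?layer_ge0);
  try (by move=> x _; rewrite lee_fin addr_ge0 ?layer_ge0);
  try (by apply/measurable_EFinP; apply: measurable_layer);
  try (by apply/measurable_EFinP; apply: measurable_funD; apply: measurable_layer).
apply: le_integral_nonneg => [x|[u v]].
  by rewrite -!EFinD lee_fin !addr_ge0 ?layer_ge0.
rewrite -!EFinD lee_fin !layerE -!big_split /=.
apply: (@le_trans _ _ (\sum_i (multiplicity i)%:R^-1 * \1_[set a i] v * f (u, v))).
  apply: ler_sum => i _; rewrite -!mulrDr.
  have [vi|vi] := pselect (v = a i); last first.
    by rewrite indicE memNset // !(mulr0, mul0r).
  by rewrite vi ler_wpM2l // mulr_ge0.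
rewrite -mulr_suml sum_share; case: (_ \in _); rewrite ?mul1r ?mul0r //.
Qed.

End AtomicCoupling.

(** * The linear program of the risk boundary *)

Section BoundaryCost.
Context {R : realType} {X : pmetricType R} {N P m n : nat} (D : model X N P m n).
Hypothesis N0 : (0 < N)%N.
Hypothesis heps : 0 < eps D <= 1.
Hypothesis hrisk : 0 < risk D < 1.
Implicit Types (w r dd : 'I_N -> R).

Definition move_cost w : R := K0 D + \sum_i kappa_bar D i * w i.

Definition boundary_cost dd w r : R := move_cost w + \sum_i dd i * r i.

Definition admissible w : Prop :=
  (forall i, 0 <= w i <= N%:R^-1) /\ eps D <= \sum_i w i.

Let invN_gt0 : 0 < N%:R^-1 :> R.
Proof. by rewrite invr_gt0 ltr0n. Qed.

Lemma sum_weight_le1 w : (forall i, w i <= N%:R^-1) -> \sum_i w i <= 1.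
Proof.
move=> hw; apply: (@le_trans _ _ (\sum_(i < N) N%:R^-1)).
  by apply: ler_sum => i _.
by rewrite sumr_const card_ord -[leLHS]mulr_natl mulfV // gt_eqF // ltr0n.
Qed.

Lemma move_cost_mix l w w' :
  move_cost (fun i => (1 - l) * w i + l * w' i)
  = (1 - l) * move_cost w + l * move_cost w'.
Proof.
have -> : (1 - l) * move_cost w + l * move_cost w' = K0 D +
   ((1 - l) * (\sum_i kappa_bar D i * w i) + l * (\sum_i kappa_bar D i * w' i)).
  by rewrite /move_cost; ring.
congr (_ + _); rewrite !mulr_sumr -big_split /=; apply: eq_bigr => i _; ring.
Qed.

Lemma boundary_polytope_lower dd : (forall i, 0 <= dd i) ->
  has_lbound [set boundary_cost dd wr.1 wr.2 | wr in boundary_polytope D].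
Proof.
move=> d0; exists (K0 D - \sum_i `|kappa_bar D i|) => _ [[w r] [/= h1 h2 h3 h4] <-].
rewrite /boundary_cost /move_cost /= -addrA lerD2l -sumrN.
apply: ler_wpDr.
  by apply: sumr_ge0 => i _; rewrite mulr_ge0 //; case/andP: (h1 i).
apply: ler_sum => i _; have [/andP[r0 rw] wN] := (h1 i, h2 i).
have w1 : w i <= 1.
  by apply: le_trans wN _; rewrite invf_le1 ?ler1n ?ltr0n.
rewrite lerNl -mulrN (le_trans (ler_norm _)) // normrM normrN.
by rewrite (ger0_norm (le_trans r0 rw)) ler_piMr.
Qed.

(** It suffices that at least the fraction [risk D] of the moved mass is
    unsafe: scaling the unsafe part down only lowers the cost. *)
Lemma vartheta_le dd w r : (forall i, 0 <= dd i) -> admissible w ->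
  (forall i, 0 <= r i <= w i) -> risk D * (\sum_i w i) <= \sum_i r i ->
  vartheta D dd <= boundary_cost dd w r.
Proof.
move=> d0 [w0 we] hr hwr; have [/andP[e0 _] /andP[k0 _]] := (heps, hrisk).
have W0 : 0 < \sum_i w i by apply: lt_le_trans we.
have V0 : 0 < \sum_i r i by apply: lt_le_trans hwr; apply: mulr_gt0.
pose s := risk D * (\sum_i w i) / \sum_i r i.
have s1 : s <= 1 by rewrite ler_pdivrMr // mul1r.
have s0 : 0 <= s by rewrite divr_ge0 ?mulr_ge0 ?ltW.
have r0 i : 0 <= r i by case/andP: (hr i).
have sr i : s * r i <= r i by rewrite ler_piMl.
apply: (@le_trans _ _ (boundary_cost dd w (fun i => s * r i))).
  apply: ge_inf; first exact: boundary_polytope_lower.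
  exists (w, fun i => s * r i) => //; split=> //= [i|i|].
  - by rewrite mulr_ge0 //= (le_trans (sr i)) //; case/andP: (hr i).
  - by case/andP: (w0 i).
  - by rewrite -mulr_sumr divfK // gt_eqF.
by rewrite lerD2l; apply: ler_sum => i _; rewrite ler_wpM2l.
Qed.

Lemma vartheta_ge dd c :
  (forall w r, admissible w -> (forall i, 0 <= r i <= w i) ->
     \sum_i r i = risk D * (\sum_i w i) -> c <= boundary_cost dd w r) ->
  c <= vartheta D dd.
Proof.
move=> hc; have [/andP[e0 e1] /andP[k0 k1]] := (heps, hrisk).
apply: lb_le_inf => [|_ [[w r] [/= h1 h2 h3 h4] <-]]; last first.
  apply: hc => //; split=> // i; rewrite h2 andbT.
  by case/andP: (h1 i) => r0; apply: le_trans.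
pose w (_ : 'I_N) : R := N%:R^-1.
exists (boundary_cost dd w (fun i => risk D * w i)).
exists (w, fun i => risk D * w i) => //; split=> //= [i||].
- by rewrite mulr_ge0 ?(ltW k0) ?(ltW invN_gt0) //= ler_piMl ?(ltW k1) // ltW.
- by rewrite sumr_const card_ord -[leRHS]mulr_natl mulfV // gt_eqF // ltr0n.
- by rewrite -mulr_sumr.
Qed.

Lemma vartheta_lt dd c : vartheta D dd < c -> exists w r,
  [/\ admissible w, forall i, 0 <= r i <= w i,
      \sum_i r i = risk D * (\sum_i w i) & boundary_cost dd w r < c].
Proof.
move=> hlt; apply: contrapT => hno; move: hlt; apply/negP; rewrite -leNgt.
apply: vartheta_ge => w r h1 h2 h3; rewrite leNgt; apply/negP => h4.
by apply: hno; exists w, r.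
Qed.

Let dist0 p bt i : 0 <= pospart (yproj D i p + bt).
Proof. by rewrite /pospart le_max lexx orbT. Qed.

Lemma Psi_mono p b b' : b <= b' -> Psi D p b <= Psi D p b'.
Proof.
move=> bb; apply: vartheta_ge => w r h1 h2 h3.
apply: (le_trans (vartheta_le _ w r (dist0 p b) h1 h2 _)); first by rewrite h3.
rewrite lerD2l; apply: ler_sum => i _; rewrite ler_wpM2r //.
  by case/andP: (h2 i).
by rewrite /pospart ge_max !le_max lexx orbT andbT lerD2l bb.
Qed.

(** The slope of the cost in the margin is the unsafe mass, at most one. *)
Lemma Psi_lipschitz p b b' : b <= b' -> Psi D p b' <= Psi D p b + (b' - b).
Proof.
move=> bb; rewrite -lerBlDr; apply: vartheta_ge => w r h1 h2 h3.
rewrite lerBlDr.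
apply: (le_trans (vartheta_le _ w r (dist0 p b') h1 h2 _)); first by rewrite h3.
rewrite -addrA lerD2l.
apply: (@le_trans _ _ (\sum_i (pospart (yproj D i p + b) * r i + (b' - b) * r i))).
  apply: ler_sum => i _; rewrite -mulrDl ler_wpM2r //.
    by case/andP: (h2 i).
  rewrite /pospart ge_max; apply/andP; split.
    apply: (@le_trans _ _ (yproj D i p + b + (b' - b))); first by lra.
    by rewrite lerD2r le_max lexx.
  by rewrite addr_ge0 ?dist0 // subr_ge0.
rewrite big_split /= lerD2l -mulr_sumr ler_piMr ?subr_ge0 // sum_weight_le1 // => i.
case: h1 => h1 _; case/andP: (h1 i) => _; case/andP: (h2 i) => _.
exact: le_trans.
Qed.

(** The unsafe mass is at least [risk D * eps D], so the cost grows at least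
    linearly once all the margins are positive. *)
Lemma Psi_unbounded p c : exists b, c <= Psi D p b.
Proof.
have [/andP[e0 _] /andP[k0 _]] := (heps, hrisk).
pose A := K0 D - \sum_i `|kappa_bar D i|.
pose s := \sum_i `|yproj D i p|.
pose b := `|c - A| / (risk D * eps D).
have b0 : 0 <= b by rewrite divr_ge0 // ltW // mulr_gt0.
exists (s + b); apply: vartheta_ge => w r h1 h2 h3.
have r0 i : 0 <= r i by case/andP: (h2 i).
have hA : A <= move_cost w.
  rewrite /A /move_cost lerD2l -sumrN; apply: ler_sum => i _.
  case: h1 => h1 _; have /andP[w0 wN] := h1 i.
  have w1 : w i <= 1 by apply: le_trans wN _; rewrite invf_le1 ?ler1n ?ltr0n.
  rewrite lerNl -mulrN (le_trans (ler_norm _)) // normrM normrN.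
  by rewrite (ger0_norm w0) ler_piMr.
have hB : b * (risk D * eps D) <= \sum_i pospart (yproj D i p + (s + b)) * r i.
  apply: (@le_trans _ _ (\sum_i b * r i)).
    rewrite -mulr_sumr h3 ler_wpM2l // ler_wpM2l ?(ltW k0) //.
    by case: h1.
  apply: ler_sum => i _; rewrite ler_wpM2r // /pospart le_max.
  apply/orP; left; rewrite addrA lerDr.
  rewrite -lerBlDl sub0r (le_trans (ler_norm _)) // normrN.
  by rewrite /s (bigD1 i) //= lerDl sumr_ge0.
rewrite divfK in hB; last by rewrite gt_eqF // mulr_gt0.
by have := ler_norm (c - A); rewrite /boundary_cost; lra.
Qed.

Section Slater.
Context {w0 : 'I_N -> R}.
Hypothesis hw0 : admissible w0.
Hypothesis cw0 : move_cost w0 < theta D.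

(** A small admixture of the strictly affordable [w0] turns an affordable
    excess of unsafe mass into a strictly affordable one. The budget is only
    approached by the weights [w, r]: transport costs are infima that need not
    be attained. *)
Lemma vartheta_lt_excess dd W V : (forall i, 0 <= dd i) -> risk D * W < V ->
  (forall e, 0 < e -> exists w r, [/\ admissible w, forall i, 0 <= r i <= w i,
     \sum_i w i = W, \sum_i r i = V & boundary_cost dd w r < theta D + e]) ->
  vartheta D dd < theta D.
Proof.
move=> d0 WV happ; have [/andP[e0 _] /andP[k0 k1]] := (heps, hrisk).
(* [l] is such that the excess [(1 - l) * x] left by the mixture pays for the
   additional mass [l * \sum_i w0 i <= l]. *)
pose g := theta D - move_cost w0; have g0 : 0 < g by rewrite subr_gt0.
pose x := V - risk D * W; have x0 : 0 < x by rewrite subr_gt0.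
pose l := x / (1 + x); have x1 : 0 < 1 + x by rewrite addr_gt0.
have l0 : 0 < l by rewrite divr_gt0.
have l1E : 1 - l = (1 + x)^-1 by rewrite /l; field; rewrite gt_eqF.
have l1 : 0 < 1 - l by rewrite l1E invr_gt0.
have lE : (1 - l) * x = l by rewrite l1E mulrC.
clearbody l.
have e0' : 0 < l * g / 2 by rewrite divr_gt0 // mulr_gt0.
have [w [r [[hw wE] hr hW hV hc]]] := happ _ e0'.
have [hw0' wE0] := hw0.
apply: (@le_lt_trans _ _ (boundary_cost dd
    (fun i => (1 - l) * w i + l * w0 i) (fun i => (1 - l) * r i))).
  apply: vartheta_le => //.
  - split=> [i|].
      have [/andP[a1 a2] /andP[b1 b2]] := (hw i, hw0' i).
      rewrite addr_ge0 ?mulr_ge0 ?(ltW l0) ?(ltW l1) //=.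
      have -> : N%:R^-1 = (1 - l) * N%:R^-1 + l * N%:R^-1 :> R by ring.
      by rewrite lerD // ler_wpM2l // ltW.
    rewrite /= big_split /= -!mulr_sumr.
    have -> : eps D = (1 - l) * eps D + l * eps D by ring.
    by rewrite lerD // ler_wpM2l // ltW.
  - move=> i; have [/andP[a1 a2] /andP[b1 b2]] := (hr i, hw0' i).
    rewrite /= mulr_ge0 ?(ltW l1) //= ler_wpDr ?mulr_ge0 ?(ltW l0) //.
    by rewrite ler_wpM2l // ltW.
  - rewrite /= big_split /= -!mulr_sumr hW hV.
    have w01 : \sum_i w0 i <= 1 by apply: sum_weight_le1 => i; case/andP: (hw0' i).
    have h : risk D * (l * \sum_i w0 i) <= l.
      rewrite -[leRHS]mul1r; apply: ler_pM; rewrite ?(ltW k0) ?(ltW k1) //.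
        by rewrite mulr_ge0 ?(ltW l0) // (le_trans (ltW e0)).
      by rewrite -[leRHS]mulr1 ler_wpM2l // ltW.
    by move: h; rewrite -[X in _ <= X]lE /x; lra.
rewrite /boundary_cost move_cost_mix.
have -> : \sum_i dd i * ((1 - l) * r i) = (1 - l) * \sum_i dd i * r i.
  by rewrite mulr_sumr; apply: eq_bigr => i _; ring.
move: hc; rewrite /boundary_cost; set C := \sum_i _ * r i => hc.
have h1 : (1 - l) * (move_cost w + C) < (1 - l) * (theta D + l * g / 2).
  by rewrite ltr_pM2l.
have h2 : (1 - l) * (l * g / 2) < l * g.
  have lg : 0 < l * g by rewrite mulr_gt0.
  have : (1 - l) * (l * g / 2) <= l * g / 2 by rewrite ler_piMl ?(ltW e0') //; lra.
  by lra.
have h3 : l * move_cost w0 = l * theta D - l * g by rewrite /g; ring.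
by lra.
Qed.

Lemma rho_set_ubound (A : {set 'I_N}) : has_ubound
  [set \sum_(i in A) w i - risk D * \sum_(i < N) w i | w in quantile_polytope D].
Proof.
exists 1 => _ [w [hw wE _] <-].
have [/andP[e0 _] /andP[k0 _]] := (heps, hrisk).
have W0 : 0 <= \sum_i w i by apply: le_trans wE; apply: ltW.
rewrite lerBlDr ler_wpDr ?(mulr_ge0 (ltW k0) W0) //.
apply: (@le_trans _ _ (\sum_i w i)).
  rewrite [leLHS]big_mkcond /=; apply: ler_sum => i _.
  by case: ifP => // _; case/andP: (hw i).
by apply: sum_weight_le1 => i; case/andP: (hw i).
Qed.

Lemma rho_gt0 (A : {set 'I_N}) : 0 < rho D A -> exists w,
  quantile_polytope D w /\ risk D * (\sum_i w i) < \sum_(i in A) w i.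
Proof.
have S0 : [set \sum_(i in A) w i - risk D * \sum_(i < N) w i
           | w in quantile_polytope D] !=set0.
  exists (\sum_(i in A) w0 i - risk D * \sum_i w0 i), w0 => //.
  by case: hw0; split=> //; apply: ltW.
move=> /(sup_gt S0) [_ [w hw <-] hpos].
by exists w; split=> //; rewrite -subr_gt0.
Qed.

(** Some sample value qualifies: at the largest one every sample is counted, and
    the total mass exceeds the fraction [risk D] of itself. *)
Lemma quantile_attained p : exists i, quantile D p = yproj D i p /\
  0 < rho D [set j | yproj D j p <= quantile D p]%SET.
Proof.
have [/andP[e0 _] /andP[k0 k1]] := (heps, hrisk).
pose S := [set q | (exists i, q = yproj D i p) /\
               0 < rho D [set i | yproj D i p <= q]%SET].
pose c i := yproj D i p; pose ok := [pred i | 0 < rho D [set j | c j <= c i]%SET].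
pose imax := [arg max_(i > Ordinal N0) c i]%O.
have okmax : ok imax.
  rewrite /= /imax; case: arg_maxP => // i _ hi.
  have -> : [set j | c j <= c i]%SET = [set: 'I_N]%SET.
    by apply/setP => j; rewrite !inE; apply: hi.
  apply: (@lt_le_trans _ _ (\sum_(j in [set: 'I_N]%SET) w0 j
                            - risk D * \sum_j w0 j)).
    rewrite (eq_bigl xpredT) => [|j]; last by rewrite inE.
    rewrite subr_gt0 -[ltRHS]mul1r ltr_pM2r //.
    by case: hw0 => _; apply: lt_le_trans.
  apply: ub_le_sup; first exact: rho_set_ubound.
  by exists w0 => //; case: hw0; split=> //; apply: ltW.
case: (arg_minP c okmax) => i oki hi.
suff -> : quantile D p = c i by exists i.
apply/eqP; rewrite eq_le; apply/andP; split.
  apply: ge_inf; last by split; [exists i|].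
  by exists (c i) => _ [[j ->] hj]; apply: hi.
apply: lb_le_inf; first by exists (c i); split; [exists i|].
by move=> _ [[j ->] hj]; apply: hi.
Qed.

(** At the scalar margin [- quantile D p] the samples below the quantile are
    already on the unsafe side, so their mass is moved at no cost in the
    outcome space. *)
Lemma Psi_quantile_lt p : Psi D p (- quantile D p) < theta D.
Proof.
have [_ [_ hpos]] := quantile_attained p.
set A := [set j | _]%SET in hpos.
have [w [[hw wE wc] hA]] := rho_gt0 _ hpos.
apply: (vartheta_lt_excess _ (\sum_i w i) (\sum_(i in A) w i)) => //.
move=> e e0; exists w, (fun i => if i \in A then w i else 0); split=> //.
- by move=> i; have /andP[wi _] := hw i; case: ifP => _; rewrite ?wi ?lexx.
- by rewrite -big_mkcond.
rewrite /boundary_cost [X in _ + X]big1 ?addr0; last first.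
  move=> i _; case: ifP => [|_]; rewrite ?mulr0 // inE => hi.
  rewrite (_ : pospart _ = 0) ?mul0r // /pospart.
  by apply/max_idPr; rewrite subr_le0.
by apply: le_lt_trans wc _; rewrite ltrDl.
Qed.

Lemma Psi_threshold p : exists bl,
  is_min [set bt | theta D <= Psi D p bt] bl /\ - quantile D p < bl.
Proof.
pose S := [set bt | theta D <= Psi D p bt].
have Sq b : S b -> - quantile D p < b.
  move=> hb; rewrite ltNge; apply/negP => /(Psi_mono p) hle.
  by have := le_lt_trans (le_trans hb hle) (Psi_quantile_lt p); rewrite ltxx.
have Slb : has_lbound S by exists (- quantile D p) => b /Sq /ltW.
have S0 : S !=set0 by have [b hb] := Psi_unbounded p (theta D); exists b.
have Sinf : S (inf S).
  apply/ler_addgt0Pr => e e0.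
  have [b Sb hb] := inf_adherent e0 (conj S0 Slb).
  apply: (le_trans Sb); apply: (le_trans (Psi_lipschitz p (inf S) b _)).
    exact: ge_inf.
  by rewrite lerD2l lerBlDl ltW.
exists (inf S); split; last exact: Sq.
by split=> // b Sb; apply: ge_inf.
Qed.

End Slater.

End BoundaryCost.

(** * Transport plans and the robust chance constraint *)

Lemma borel_set1 {T : ptopologicalType} (x : T) : hausdorff_space T ->
  measurable ([set x] : set (borel T)).
Proof.
move=> hT; rewrite -[X in measurable X]setCK; apply: measurableC.
apply: sub_sigma_algebra; apply: closed_openC.
exact: accessible_closed_set1 (hausdorff_accessible hT) x.
Qed.

Section Transport.
Context {R : realType} {X : pmetricType R} {N P m n : nat} (D : model X N P m n).
Notation Y := 'cV[R]_m.
Notation XY := (borel X * borel Y)%type.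
Hypothesis N0 : (0 < N)%N.
Hypothesis hnorm : is_norm (normY D).
Hypothesis heps : 0 < eps D <= 1.
Hypothesis hrisk : 0 < risk D < 1.
Hypothesis hin : nbd D !=set0.
Hypothesis hout : ~` nbd D !=set0.
Hypothesis hmeas : measurable (nbd D : set (borel X)).

Let atom (i : 'I_N) : XY := (xhat D i, yhat D i).

Let matom i : measurable [set atom i].
Proof.
have -> : [set atom i] = [set xhat D i] `*` [set yhat D i].
  by apply/seteqP; split => [[u v] [-> ->]|[u v] [/= -> ->]].
apply: measurableX; apply: borel_set1; first exact: metric_hausdorff.
exact: (@norm_hausdorff R 'cV[R]_m).
Qed.

Let dist_lbound i (S : set X) : has_lbound [set mdist (xhat D i) x | x in S].
Proof. by exists 0 => _ [x _ <-]; apply: mdist_ge0. Qed.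

Lemma kappa_in_ge0 i : 0 <= kappa_in D i.
Proof.
apply: lb_le_inf => [|_ [x _ <-]]; last exact: mdist_ge0.
by have [x hx] := hin; exists (mdist (xhat D i) x), x.
Qed.

Lemma kappa_out_ge0 i : 0 <= kappa_out D i.
Proof.
apply: lb_le_inf => [|_ [x _ <-]]; last exact: mdist_ge0.
by have [x hx] := hout; exists (mdist (xhat D i) x), x.
Qed.

Lemma dist_XY_ge0 u v : 0 <= dist_XY D u v.
Proof. by rewrite addr_ge0 ?mdist_ge0 // is_norm_ge0. Qed.

(** In [K0] every sample pays for leaving the conditioning event; [kappa_bar]
    corrects this for the mass that enters it. *)
Lemma boundary_costE dd w r : boundary_cost D dd w r =
  \sum_i kappa_in D i * w i + \sum_i kappa_out D i * (N%:R^-1 - w i)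
  + \sum_i dd i * r i.
Proof.
rewrite /boundary_cost /move_cost /K0; congr (_ + _).
rewrite mulr_sumr -!big_split /=; apply: eq_bigr => i _.
by rewrite /kappa_bar; ring.
Qed.

Definition is_coupling (pi : probability (XY * XY)%type R) (Q : probability XY R) :=
  (forall A, measurable A -> pi (A `*` setT) = Q A) /\
  (forall A, measurable A -> pi (setT `*` A) = empirical D A).

(** The weights are the masses that the plan sends from each sample into the
    event and into its unsafe part; the distances to these sets bound the cost
    from below. *)
Lemma coupling_weights Q pi (U : set Y) dd : is_coupling pi Q ->
  measurable (U : set (borel Y)) -> (forall i, 0 <= dd i) ->
  (forall i y, U y -> dd i <= normY D (y - yhat D i)) ->
  exists w r, [/\ (forall i, 0 <= w i <= N%:R^-1), (forall i, 0 <= r i <= w i),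
    \sum_i w i = fine (proba_nbd D Q),
    \sum_i r i = fine (Q (nbd D `*` U)) &
    ((boundary_cost D dd w r)%:E <= \int[pi]_u (dist_XY D u.1 u.2)%:E)%E].
Proof.
move=> [pi1 pi2] mU dd0 hdd.
pose A : set XY := nbd D `*` setT; pose B : set XY := nbd D `*` U.
have mA : measurable A by apply: measurableX.
have mB : measurable B by apply: measurableX.
exists (atom_mass atom pi A), (atom_mass atom pi B).
have hC := atom_mass_setC atom pi matom pi2 _ _ mA.
split=> [i|i|||].
- by rewrite atom_mass_ge0 -(hC i) lerDl atom_mass_ge0.
- rewrite atom_mass_ge0 atom_mass_mono //.
  by move=> [x y] [].
- by rewrite (sum_atom_mass atom pi matom pi2 _ mA) pi1.
- by rewrite (sum_atom_mass atom pi matom pi2 _ mB) pi1.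
rewrite boundary_costE.
have hC' i : N%:R^-1 - atom_mass atom pi A i = atom_mass atom pi (~` A) i.
  by rewrite -(hC i) addrC addKr.
under [X in _ + X + _]eq_bigr do rewrite hC'.
apply: (coupling_cost_ge atom pi matom (fun u => dist_XY D u.1 u.2)) => //.
- by move=> u; apply: dist_XY_ge0.
- by move=> i; rewrite kappa_in_ge0 kappa_out_ge0.
move=> [x y] i; rewrite /dist_XY /= metric_sym.
have nY : 0 <= normY D (y - yhat D i) by apply: is_norm_ge0.
have [nx|nx] := pselect (nbd D x).
  have -> : \1_A (x, y) = 1 :> R by rewrite indicE mem_set.
  have -> : \1_(~` A) (x, y) = 0 :> R by rewrite indicE memNset //; apply.
  rewrite mulr1 mulr0 addr0; apply: lerD.
    by apply: ge_inf; [exact: dist_lbound | exists x].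
  have [Uy|Uy] := pselect (U y).
    have -> : \1_B (x, y) = 1 :> R by rewrite indicE mem_set.
    by rewrite mulr1 hdd.
  have -> : \1_B (x, y) = 0 :> R by rewrite indicE memNset // => -[].
  by rewrite mulr0.
have -> : \1_A (x, y) = 0 :> R by rewrite indicE memNset // => -[].
have -> : \1_B (x, y) = 0 :> R by rewrite indicE memNset // => -[].
have -> : \1_(~` A) (x, y) = 1 :> R by rewrite indicE mem_set // => -[].
rewrite !mulr0 mulr1 add0r; apply: lerD => //.
by apply: ge_inf; [exact: dist_lbound | exists x].
Qed.

Let proba_fin (Q : probability XY R) (A : set XY) : measurable A ->
  Q A = (fine (Q A))%:E.
Proof.
move=> mA; rewrite fineK // ge0_fin_numE //.
by rewrite (le_lt_trans (probability_le1 _ mA)) // ltry.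
Qed.

Lemma Wdist_lt (Q : probability XY R) c : (Wdist D Q < c%:E)%E ->
  exists pi, is_coupling pi Q /\ (\int[pi]_u (dist_XY D u.1 u.2)%:E < c%:E)%E.
Proof.
by move=> /ereal_inf_lt [_ [pi [h1 h2] <-] hc]; exists pi; split.
Qed.

Let eps_le_fine Q :
  ((eps D)%:E <= proba_nbd D Q)%E -> eps D <= fine (proba_nbd D Q).
Proof.
by move=> h; rewrite -lee_fin -proba_fin //; apply: measurableX.
Qed.

(** A distribution at distance less than [theta D] has a plan of cost less than
    [theta D], whose weights stay strictly within the budget. *)
Lemma slater_weights : (theta_min D < (theta D)%:E)%E ->
  exists w, admissible D w /\ move_cost D w < theta D.
Proof.
move=> /ereal_inf_lt [_ [Q /= hQ <-]] /Wdist_lt [pi [hpi hc]].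
have no_unsafe i y : set0 y -> 0 <= normY D (y - yhat D i) by [].
have [w [r [h1 h2 h3 h4 h5]]] :=
  coupling_weights Q pi set0 (fun=> 0) hpi measurable0 (fun=> lexx 0) no_unsafe.
exists w; split; first by split=> //; rewrite h3 eps_le_fine.
have := le_lt_trans h5 hc; rewrite lte_fin /boundary_cost.
by rewrite [X in _ + X]big1 ?addr0 // => i _; rewrite mul0r.
Qed.

(** A violating distribution has fixed masses [W] and [V > risk D * W] of the
    event and of its unsafe part, while its plans have costs tending to at most
    [theta D]. *)
Lemma robust_cc_of_vartheta z dd w0 :
  admissible D w0 -> move_cost D w0 < theta D ->
  measurable (unsafe D z : set (borel Y)) -> (forall i, 0 <= dd i) ->
  (forall i y, unsafe D z y -> dd i <= normY D (y - yhat D i)) ->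
  theta D <= vartheta D dd -> robust_cc D z.
Proof.
move=> hw0 cw0 mU dd0 hdd hth; apply: ge_ereal_sup => _ [Q [hW hQ] <-].
rewrite lee_fin leNgt; apply/negP => hviol; move: hth; apply/negP; rewrite -ltNge.
have hE := eps_le_fine Q hQ; have [/andP[e0 _] /andP[k0 _]] := (heps, hrisk).
move: hviol; rewrite /cond_violation ltr_pdivlMr ?(lt_le_trans e0) // => hviol.
apply: (vartheta_lt_excess D N0 heps hrisk hw0 cw0 dd _ _ dd0 hviol) => e epos.
have /Wdist_lt [pi [hpi hc]] : (Wdist D Q < (theta D + e)%:E)%E.
  by apply: le_lt_trans hW _; rewrite lte_fin ltrDl.
have [w [r [h1 h2 h3 h4 h5]]] := coupling_weights Q pi _ dd hpi mU dd0 hdd.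
exists w, r; split=> //; first by split=> //; rewrite h3.
by have := le_lt_trans h5 hc; rewrite lte_fin.
Qed.

(** Of the sample [i], the mass [r i] is moved into the event and to the unsafe
    side, the mass [w i - r i] into the event only, and the rest out of the
    event. The destinations almost attain the distances: [e] is half of the
    unused budget, and is paid at most twice per unit of mass. *)
Lemma attack z dd w r : measurable (unsafe D z : set (borel Y)) ->
  (forall i e, 0 < e -> exists y, unsafe D z y /\
     normY D (y - yhat D i) <= dd i + e) ->
  admissible D w -> (forall i, 0 <= r i <= w i) ->
  risk D * (\sum_i w i) < \sum_i r i -> boundary_cost D dd w r < theta D ->
  ~ robust_cc D z.
Proof.
move=> mU hdd [hw hwe] hr hexc hcost.
pose e := (theta D - boundary_cost D dd w r) / 2.
have e0 : 0 < e by rewrite divr_gt0 // subr_gt0.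
have near_inf (S : set X) i : S !=set0 -> exists x, S x /\
    mdist x (xhat D i) <= inf [set mdist (xhat D i) x | x in S] + e.
  move=> [x Sx]; have [|_ [x' Sx' <-] hx'] := @inf_adherent _
      [set mdist (xhat D i) x | x in S] _ e0.
    by split; [exists (mdist (xhat D i) x), x | exact: dist_lbound].
  by exists x'; split=> //; rewrite metric_sym ltW.
have /choice [xin hxin] := fun i => near_inf _ i hin.
have /choice [xout hxout] := fun i => near_inf _ i hout.
have /choice [ybad hybad] := fun i => hdd i e e0.
(* The three summands of [K] index these three parts. *)
pose K := ('I_N + ('I_N + 'I_N))%type.
pose c (k : K) : R := match k with
  | inl i => r i | inr (inl i) => w i - r i | inr (inr i) => N%:R^-1 - w i end.
pose a (k : K) : XY := match k with
  | inl i => (xin i, ybad i) | inr (inl i) => (xin i, yhat D i)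
  | inr (inr i) => (xout i, yhat D i) end.
pose s (k : K) : XY := match k with
  | inl i => atom i | inr (inl i) => atom i | inr (inr i) => atom i end.
have sumK (f : K -> R) : \sum_k f k
    = \sum_i (f (inl i) + f (inr (inl i)) + f (inr (inr i))).
  by rewrite !big_sumType /= addrA -!big_split.
have c0 k : 0 <= c k.
  by case: k => [i|[i|i]] /=; rewrite ?subr_ge0; [case/andP: (hr i)
    |case/andP: (hr i)|case/andP: (hw i)].
have c1 : \sum_k c k = 1.
  rewrite sumK /= (eq_bigr (fun=> N%:R^-1)) => [|i _]; last by ring.
  by rewrite sumr_const card_ord -[LHS]mulr_natl mulfV // gt_eqF // ltr0n.
have [Q [QE _]] := finite_mixture c a c0 c1.
have [pi [piE pi_int]] := finite_mixture c (fun k => (a k, s k)) c0 c1.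
have hpi : is_coupling pi Q.
  split=> A mA.
    rewrite piE QE; congr EFin; apply: eq_bigr => k _.
    by rewrite !indicE in_setX /= in_setT andbT.
  rewrite piE /empirical sumEFin -EFinM; congr EFin.
  rewrite sumK mulr_sumr; apply: eq_bigr => i _.
  by rewrite !indicE !in_setX /= !in_setT /= -/(atom i); ring.
have hW : (Wdist D Q <= (theta D)%:E)%E.
  apply: (@le_trans _ _ (\int[pi]_u (dist_XY D u.1 u.2)%:E)%E).
    by apply: ereal_inf_lbound; exists pi.
  apply: le_trans (pi_int (fun u => dist_XY D u.1 u.2) _) _.
    by move=> u; apply: dist_XY_ge0.
  rewrite lee_fin sumK.
  apply: (@le_trans _ _ (boundary_cost D dd w r +
                         (\sum_(i < N) N%:R^-1 + \sum_i r i) * e)).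
    rewrite boundary_costE mulrDl !mulr_suml -!big_split /=.
    apply: ler_sum => i _; rewrite /dist_XY /= subrr is_norm0 // !addr0.
    have [/andP[r0 rw] /andP[_ wN]] := (hr i, hw i).
    have [[[_ h1] [_ h2]] [_ h3]] := (hxin i, hxout i, hybad i).
    rewrite -/(kappa_in D i) in h1; rewrite -/(kappa_out D i) in h2.
    have t1 : w i * mdist (xin i) (xhat D i) <= w i * (kappa_in D i + e).
      by rewrite ler_wpM2l // (le_trans r0).
    have t2 : (N%:R^-1 - w i) * mdist (xout i) (xhat D i)
        <= (N%:R^-1 - w i) * (kappa_out D i + e).
      by rewrite ler_wpM2l // subr_ge0.
    have t3 : r i * normY D (ybad i - yhat D i) <= r i * (dd i + e).
      by rewrite ler_wpM2l.
    by move: t1 t2 t3; lra.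
  have N1 : \sum_(i < N) (N%:R^-1 : R) = 1.
    by rewrite sumr_const card_ord -[LHS]mulr_natl mulfV // gt_eqF // ltr0n.
  have r1 : \sum_i r i <= 1.
    apply: sum_weight_le1 => // i.
    by case/andP: (hr i) => _; case/andP: (hw i) => _ h1 h2; apply: le_trans h1.
  have : (1 + \sum_i r i) * e <= 2 * e by rewrite ler_wpM2r ?(ltW e0) //; lra.
  by rewrite N1 /e; lra.
have QA : Q (nbd D `*` setT) = (\sum_i w i)%:E.
  rewrite QE sumK; congr EFin; apply: eq_bigr => i _.
  rewrite !indicE !in_setX /= !in_setT !andbT.
  have [[h1 _] [h2 _]] := (hxin i, hxout i).
  by rewrite (mem_set h1) memNset // mulr1 mulr1 mulr0 addr0 addrC subrK.
have QB : \sum_i r i <= fine (Q (nbd D `*` unsafe D z)).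
  rewrite QE /= sumK; apply: ler_sum => i _.
  have [[h1 _] [h2 _]] := (hxin i, hybad i).
  rewrite -addrA -[leLHS]addr0; apply: lerD.
    by rewrite indicE in_setX /= !mem_set //= mulr1.
  by rewrite addr_ge0 // mulr_ge0 ?(c0 (inr (inl i))) ?(c0 (inr (inr i))).
move=> /(le_trans _) hrob.
have : ((cond_violation D z Q)%:E <= (risk D)%:E)%E.
  apply: hrob; apply: ereal_sup_ubound; exists Q => //; split=> //.
  by rewrite /= /proba_nbd QA lee_fin.
have [/andP[eps0 _] _] := (heps, hrisk).
rewrite lee_fin /cond_violation /proba_nbd QA /= ler_pdivrMr; last first.
  by apply: lt_le_trans hwe.
by move/(le_trans QB)/(lt_le_trans hexc); rewrite ltxx.
Qed.

(** On the boundary polytope the unsafe part is exactly the fraction [risk D];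
    as that fraction is below one, a little more can be made unsafe. *)
Lemma vartheta_of_robust_cc z dd : measurable (unsafe D z : set (borel Y)) ->
  (forall i, 0 <= dd i) ->
  (forall i e, 0 < e -> exists y, unsafe D z y /\
     normY D (y - yhat D i) <= dd i + e) ->
  robust_cc D z -> theta D <= vartheta D dd.
Proof.
move=> mU dd0 hdd hrob; rewrite leNgt; apply/negP => /(vartheta_lt D N0 heps hrisk).
move=> [w [r [hw hr hE hc]]]; move: hrob.
have [/andP[e0 _] /andP[k0 k1]] := (heps, hrisk).
pose g := theta D - boundary_cost D dd w r; have g0 : 0 < g by rewrite subr_gt0.
(* [C] is the cost of making all the moved mass unsafe, and the fraction [t] of
   it stays within the slack [g]. *)
pose C := \sum_i dd i * (w i - r i).
have C0 : 0 <= C.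
  by apply: sumr_ge0 => i _; rewrite mulr_ge0 // subr_ge0; case/andP: (hr i).
have G0 : 0 < g + C + 1 by lra.
pose t := g / (g + C + 1).
have t0 : 0 < t by rewrite divr_gt0.
have t1 : t <= 1 by rewrite ler_pdivrMr //; lra.
have tC : t * C < g.
  by rewrite /t mulrAC ltr_pdivrMr // ltr_pM2l //; lra.
apply: (attack z dd w (fun i => r i + t * (w i - r i))) => //.
- move=> i; have /andP[r0 rw] := hr i.
  have h : t * (w i - r i) <= w i - r i by rewrite ler_piMl // subr_ge0.
  have : 0 <= t * (w i - r i) by rewrite mulr_ge0 ?(ltW t0) // subr_ge0.
  by move: h; lra.
- rewrite big_split /= -mulr_sumr sumrB hE ltrDl mulr_gt0 // subr_gt0.
  by rewrite gtr_pMl //; apply: lt_le_trans (hw.2).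
rewrite /boundary_cost; under eq_bigr do rewrite mulrDr mulrCA.
rewrite big_split /= -mulr_sumr addrA -/C.
by move: tC; rewrite /g /boundary_cost; lra.
Qed.

End Transport.

(** * Distances to the unsafe set *)

Section Safety.
Context {R : realType} {X : pmetricType R} {N P m n : nat} (D : model X N P m n).
Hypothesis hnorm : is_norm (normY D).
Hypothesis hb : forall p, coefy D p <> 0.

Let marginE i p z : margin D i p z = (dot (yhat D i) (coefy D p)
  + (offset D p - dot z (coefz D p))) / dual_norm (normY D) (coefy D p).
Proof. by rewrite /margin /yproj /betaz -mulrDl. Qed.

Lemma unsafe_approx p z i e : 0 < e -> exists y, unsafe D z y /\
  normY D (y - yhat D i) <= pospart (margin D i p z) + e.
Proof.
move=> e0; have [y [hy hd]] := halfspace_dist_approx hnorm (coefy D p)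
  (offset D p - dot z (coefz D p)) (yhat D i) e (hb p) e0.
exists y; rewrite marginE; split=> //.
by move=> /(_ p); rewrite -addrA ltNge hy.
Qed.

Lemma unsafe_dist_ge p z i y : (forall p', p' = p) -> unsafe D z y ->
  pospart (margin D i p z) <= normY D (y - yhat D i).
Proof.
move=> hp hy; rewrite marginE; apply: halfspace_dist_ge => //.
rewrite leNgt; apply/negP => hy'; apply: hy => p'.
by rewrite (hp p') -addrA.
Qed.

End Safety.

(** * Cuts and coefficients of the mixed-integer program *)

Section MixedInteger.
Context {R : realType} {X : pmetricType R} {N P m n : nat} (D : model X N P m n).
Hypothesis N0 : (0 < N)%N.
Hypothesis heps : 0 < eps D <= 1.
Hypothesis hrisk : 0 < risk D < 1.
Implicit Types (M : 'I_N -> 'I_P -> R) (Dl : 'I_N -> R).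

(** Weak duality: [t], [lambda], [s] and [v] are multipliers for the linear
    program defining [vartheta], and [delta] lies below the distances whatever
    the value of the binary variables. *)
Lemma mip_Psi_ge M Dl u p : mip_feasible D M Dl u ->
  theta D <= Psi D p (betaz D p (mp_z u)).
Proof.
move=> [hbud hi hlam ht _].
have [/andP[e0 e1] /andP[k0 k1]] := (heps, hrisk).
have invN0 : 0 <= N%:R^-1 :> R by rewrite invr_ge0.
have hd i : mp_delta u i <= pospart (margin D i p (mp_z u)).
  have [_ _ /andP[d0 d1] /(_ p) d2 _] := hi i; rewrite /pospart le_max.
  case: (mp_bin u i) d1 d2 => /= d1 d2.
    by rewrite orbC (le_trans d1) // subrr mulr0.
  by rewrite (le_trans d2) // mulr0 addr0.
apply: (vartheta_ge D N0 heps hrisk) => w r [hw hwe] hr hE.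
apply: (le_trans hbud).
set T := mp_t u in hlam ht hbud *; set L := mp_lambda u in hlam hbud *.
have key i : T * r i - L * w i - N%:R^-1 * mp_v u i <=
    kappa_bar D i * w i + pospart (margin D i p (mp_z u)) * r i.
  have [h1 h2 _ _ [h3 h4]] := hi i.
  have [/andP[w0 wN] /andP[r0 rw]] := (hw i, hr i).
  have a1 : (T - mp_s u i - kappa_bar D i) * r i
      <= pospart (margin D i p (mp_z u)) * r i.
    by rewrite ler_wpM2r // (le_trans _ (hd i)) // lerBlDr.
  have a2 : - mp_s u i * (w i - r i) <= kappa_bar D i * (w i - r i).
    by rewrite ler_wpM2r ?subr_ge0 // lerNl.
  have a3 : mp_s u i * w i <= (mp_v u i + L) * w i by rewrite ler_wpM2r.
  have a4 : mp_v u i * w i <= mp_v u i * N%:R^-1 by rewrite ler_wpM2l.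
  by move: a1 a2 a3 a4; lra.
have sum_key : T * (\sum_i r i) - L * (\sum_i w i) - N%:R^-1 * (\sum_i mp_v u i)
   <= \sum_i kappa_bar D i * w i
      + \sum_i pospart (margin D i p (mp_z u)) * r i.
  rewrite !mulr_sumr -!sumrB -big_split /=; exact: ler_sum.
have hW : (risk D * T - L) * eps D <= (risk D * T - L) * \sum_i w i.
  by rewrite ler_wpM2l // subr_ge0.
move: sum_key hW; rewrite hE /boundary_cost /move_cost /margin.
lra.
Qed.

Lemma M_replaced_le M bl Q i p : M_replaced D M bl Q i p <= M i p.
Proof. by rewrite /M_replaced; case: ifP => // _; rewrite /M_tilde ge_min lexx. Qed.

Lemma mip_feasible_mono M M' Dl u : (forall i p, M i p <= M' i p) ->
  mip_feasible D M Dl u -> mip_feasible D M' Dl u.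
Proof.
move=> MM [h1 h2 h3 h4 h5]; split=> // i.
have [g1 g2 g3 g4 g5] := h2 i; split=> // p.
by apply: (le_trans (g4 p)); rewrite lerD2l ler_wpM2r.
Qed.

(** A constraint with its binary switched on reads [0 <= margin + M]. Under the
    cut the margin is at least [yproj + bl], which the smaller coefficient
    already compensates. *)
Lemma mip_feasible_replaced M Dl bl (Q : {set 'I_P}) u :
  (forall i p z, Zset D z -> pospart (- margin D i p z) <= M i p) ->
  quantile_cuts D bl Q u -> mip_feasible D M Dl u ->
  mip_feasible D (M_replaced D M bl Q) Dl u.
Proof.
move=> hM hcut [h1 h2 h3 h4 h5]; split=> // i.
have [g1 g2 g3 g4 g5] := h2 i; split=> // p.
move: (g4 p); rewrite /M_replaced; case: ifP => // pQ.
case: (mp_bin u i) g3 => /=; last by rewrite !mulr0.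
move=> /andP[_]; rewrite subrr mulr0 !mulr1 => d0 dM.
have m0 : 0 <= margin D i p (mp_z u) + M i p.
  have := hM i p _ h5; rewrite /pospart ge_max => /andP[+ _]; lra.
apply: (le_trans d0); rewrite /M_tilde.
have /= cut := hcut p pQ.
have [_|_] := leP (M i p); first exact: m0.
apply: (@le_trans _ _ (margin D i p (mp_z u) + (- yproj D i p - bl p))).
  by rewrite /margin; lra.
by rewrite lerD2l /pospart le_max lexx.
Qed.

End MixedInteger.

(** * The threshold and its consequences *)

Theorem theorem6 (R : realType) (X : pmetricType R) (N P m n : nat)
    (D : model X N P m n) (x0 : X) (gamma : R)
    (M : 'I_N -> 'I_P -> R) (Delta : 'I_N -> R)
    (hN : (0 < N)%N)
    (hX : polish R X)
    (hnorm : is_norm (normY D))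
    (heps : 0 < eps D <= 1)
    (hrisk : 0 < risk D < 1)
    (htheta : 0 < theta D)
    (hgamma : 0 <= gamma)
    (hx0 : nbd D x0)
    (hball : forall x, nbd D x -> mdist x0 x <= gamma)
    (hmeas : measurable (nbd D : set (borel X)))
    (hout : ~` nbd D !=set0)
    (hb : forall p, coefy D p <> 0)
    (hZ : mixed_integer_polyhedron (Zset D))
    (hZ0 : Zset D !=set0)
    (hZb : bounded_set (Zset D))
    (hS : forall z, Zset D z ->
       measurable (unsafe D z : set (borel 'cV[R]_m)) /\ unsafe D z !=set0)
    (hmin : (theta_min D < (theta D)%:E)%E)
    (hM : forall i p z, Zset D z -> pospart (- margin D i p z) <= M i p)
    (hDelta : forall i z, Zset D z -> pospart (min_margin D i z) <= Delta i) :
  exists bl : 'I_P -> R,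
    [/\ forall p, is_min [set bt | theta D <= Psi D p bt] (bl p),
        forall p z, Zset D z -> robust_cc D z -> bl p <= betaz D p z,
        forall p, (forall p' : 'I_P, p' = p) ->
          forall z, Zset D z -> (robust_cc D z <-> bl p <= betaz D p z),
        forall p, - quantile D p < bl p &
        (forall Q : {set 'I_P},
           mip_feasible D M Delta `&` quantile_cuts D bl Q
             = mip_feasible D M Delta /\
           mip_feasible D (M_replaced D M bl Q) Delta `&` quantile_cuts D bl Q
             = mip_feasible D M Delta) /\
        (forall i p, M_tilde D M bl i p <= M_quantile D M i p)].
Proof.
have hin : nbd D !=set0 by exists x0.
have [w0 [hw0 cw0]] := slater_weights D hnorm hin hout hmeas hmin.
have /choice [bl hbl] := Psi_threshold D hN heps hrisk hw0 cw0.
have bl_min p : is_min [set bt | theta D <= Psi D p bt] (bl p) by case: (hbl p).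
have bl_quantile p : - quantile D p < bl p by case: (hbl p).
have dist0 (p : 'I_P) z i : 0 <= pospart (margin D i p z).
  by rewrite /pospart le_max lexx orbT.
have cut p z : Zset D z -> robust_cc D z -> bl p <= betaz D p z.
  move=> /hS [mU _] hrob; apply: (bl_min p).2 => /=.
  apply: (vartheta_of_robust_cc D hN hnorm heps hrisk hin hout z
    (fun i => pospart (margin D i p z))) => //.
  by move=> i e e0; apply: unsafe_approx.
have mip_cut M' (Q : {set 'I_P}) u :
    mip_feasible D M' Delta u -> quantile_cuts D bl Q u.
  move=> hu p _; apply: (bl_min p).2.
  exact: mip_Psi_ge hN heps hrisk _ _ _ _ hu.
exists bl; split=> //.
- move=> p hp z Zz; split; first exact: cut.
  move=> hbz; have [mU _] := hS z Zz.
  apply: (robust_cc_of_vartheta D hN hnorm heps hrisk hin hout hmeas z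
    (fun i => pospart (margin D i p z)) w0) => //.
    by move=> i y; apply: unsafe_dist_ge.
  exact: le_trans (bl_min p).1 (Psi_mono D hN heps hrisk p _ _ hbz).
split=> [Q|i p].
  split; apply/seteqP; split=> u.
  - by case.
  - by move=> hu; split=> //; apply: mip_cut hu.
  - move=> [hu _]; apply: mip_feasible_mono hu.
    exact: M_replaced_le.
  - move=> hu; have hc := mip_cut _ Q _ hu; split=> //.
    exact: mip_feasible_replaced.
rewrite /M_tilde /M_quantile le_min !ge_min lexx /=; apply/orP; right.
rewrite /pospart ge_max !le_max lexx orbT andbT; apply/orP; left.
by have := bl_quantile p; lra.
Qed.
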